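(* Let $\lambda\in\mathcal{T}$ and suppose that $(A_\lambda,q_\lambda)$ is post-critically finite. Then $A_\lambda$ has the bounded turning property.
   Context: For $\lambda$ in the open unit disk $\mathbb{D}$ let $A_\lambda=\{\sum_{n=0}^\infty a_n\lambda^n:\ a_n\in\{0,1\}\}$, so $A_\lambda=\lambda A_\lambda\cup(\lambda A_\lambda+1)$. Let $\mathcal{T}=\{\lambda\in\mathbb{D}:\ \lambda A_\lambda\cap(\lambda A_\lambda+1)\text{ is a single point } o_\lambda\}$ (then $o_\lambda=\frac{1}{2(1-\lambda)}$). For $\lambda\in\mathcal{T}$ define $q_\lambda:A_\lambda\to A_\lambda$ by $q_\lambda(z)=z/\lambda$ if $z\in\lambda A_\lambda$ and $q_\lambda(z)=\frac{1-z}{\lambda}+\frac{1}{1-\lambda}$ if $z\in\lambda A_\lambda+1$. $(A_\lambda,q_\lambda)$ is post-critically finite if $o_\lambda$ is strictly preperiodic under $q_\lambda$. A connected, locally connected set $X\subset\mathbb{C}$ has the bounded turning property if there is $L$ such that for all $z_0,z_1\in X$ there is a connected set $[z_0,z_1]\subset X$ containing $z_0,z_1$ with $\operatorname{diam}[z_0,z_1]\le L|z_0-z_1|$. *)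

(* Defs.v *)
From HB Require Import structures.
From mathcomp Require Import all_boot all_algebra.
From mathcomp Require Import complex.
From mathcomp Require Import all_classical all_reals all_analysis.
Import numFieldTopology.Exports numFieldNormedType.Exports.

Set Implicit Arguments.
Unset Strict Implicit.
Unset Printing Implicit Defensive.

Local Open Scope classical_set_scope.
Local Open Scope ring_scope.

Definition Cx (R : realType) : Type := (R[i])^o.

Section Defs.
Variable R : realType.
Implicit Types (l z : Cx R) (X : set (Cx R)).

Definition Aset l : set (Cx R) :=
  [set z | exists a : nat -> bool,
     (fun N : nat => \sum_(n < N) ((a n)%:R * l ^+ n)) @ \oo --> z].

Definition lA l : set (Cx R) := (fun z => l * z) @` Aset l.
Definition lA1 l : set (Cx R) := (fun z => l * z + 1) @` Aset l.

Definition inT l : Prop :=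
  `|l| < 1 /\ exists o, lA l `&` lA1 l = [set o].

(* the map q_lambda (extended arbitrarily, by the second branch, off A_lambda) *)
Definition qmap l (z : Cx R) : Cx R :=
  if `[< lA l z >] then z / l else (1 - z) / l + 1 / (1 - l).

Definition strictly_preperiodic (f : Cx R -> Cx R) (x : Cx R) : Prop :=
  (exists m p : nat, (0 < p)%N /\ iter (m + p) f x = iter m f x) /\
  (forall p : nat, (0 < p)%N -> iter p f x <> x).

Definition pcf l : Prop :=
  exists o, lA l `&` lA1 l = [set o] /\ strictly_preperiodic (qmap l) o.

Definition locally_connected X : Prop :=
  forall x, X x -> forall U : set (Cx R), open U -> U x ->
    exists V : set (Cx R), [/\ open V, V x, V `&` X `<=` U & connected (V `&` X)].

(* bounded turning property; "diam K <= D" is written out as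
   "all pairwise distances in K are <= D" *)
Definition bounded_turning X : Prop :=
  [/\ connected X, locally_connected X &
   exists L : R, forall z0 z1, X z0 -> X z1 ->
     exists K : set (Cx R), [/\ K `<=` X, K z0, K z1, connected K &
       forall w w', K w -> K w' -> `|w - w'| <= (L%:C)%C * `|z0 - z1|]].

End Defs.

(* Main.v *)
(** Write c = 1/(1-l).  The attractor A is the union of its images under
    g_0 z = l z and g_1 z = c - l z, which are inverse branches of q, and these
    images meet only in o = c/2 = g_0 a = g_1 a.  If x and y lie in the same image
    g_b(A), applying q divides their distance by |l|, so one may assume that x and
    y lie in different images and join them through o.  This needs two estimates at
    the points p_k = q^(k+1)(o), of which p_0 = a: x is joined to p_k inside a
    connected set of diameter at most L |x - p_k|, and
    |x - p_k| + |y - p_k| <= C |x + y - 2 p_k| for all x, y in A.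
    No p_k is o, so points of A within a distance d of p_k lie in the same image
    as p_k; as there are only finitely many p_k, d can be chosen independent of k.
    Rescaling by q therefore reduces both estimates to points at distance at least
    d from p_k, where the first holds because A is connected, and the second by
    compactness, since x + y = 2 p_k with x <> p_k would pull back to a second
    common point of the two images. *)
Require Import Defs.
From HB Require Import structures.
From mathcomp Require Import all_boot all_order all_algebra.
From mathcomp Require Import complex.
From mathcomp Require Import all_classical all_reals all_analysis.
From mathcomp Require Import ring lra.
Import Order.TTheory GRing.Theory Num.Theory.
Import numFieldTopology.Exports numFieldNormedType.Exports.
Local Open Scope classical_set_scope.
Local Open Scope ring_scope.

Set Implicit Arguments.
Unset Strict Implicit.
Unset Printing Implicit Defensive.

(** * The real-valued modulus on the complex numbers *)

Section ComplexNorm.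
Variable R : realType.
Implicit Types (x y z : Cx R).

Local Notation nr := (@Normc.normc R).

Lemma normc_ge0 z : 0 <= nr z.
Proof. by case: z => a b; exact: sqrtr_ge0. Qed.

Lemma normc_0 : nr (0 : Cx R) = 0.
Proof. exact: Normc.normc0. Qed.

Lemma normc_1 : nr (1 : Cx R) = 1.
Proof. exact: Normc.normc1. Qed.

Lemma normc_gt0 x : x <> 0 -> 0 < nr x.
Proof.
move=> x0; rewrite lt_neqAle normc_ge0 andbT eq_sym.
by apply/eqP => /Normc.eq0_normc.
Qed.

Lemma normc_le_add x y : nr (x + y) <= nr x + nr y.
Proof. exact: le_normcD. Qed.

Lemma normc_opp z : nr (- z) = nr z.
Proof. exact: normcN. Qed.

Lemma normc_distC x y : nr (x - y) = nr (y - x).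
Proof. by rewrite -normc_opp opprB. Qed.

Lemma normcX z n : nr (z ^+ n) = nr z ^+ n.
Proof.
elim: n => [|n IHn]; first by rewrite !expr0 normc_1.
by rewrite !exprS Normc.normcM IHn.
Qed.

(** The norm of [Cx R] takes values in [R[i]], where a positive element is automatically real.
    Neighbourhoods are thus described by real radii, and the estimates can be made with the real
    modulus. *)
Lemma nbhs_normcP z (P : set (Cx R)) :
  nbhs z P <-> exists2 e : R, 0 < e & forall y, nr (z - y) < e -> P y.
Proof.
split=> [/nbhs_ballP[e /= e0 eP]|[e e0 eP]].
  have er : e \is Num.real by rewrite gtr0_real.
  exists (complex.Re e); first by move: e0; rewrite ltcE => /andP[].
  by move=> y zy; apply: eP; rewrite -ball_normE /= -(RRe_real er) ltcR.
apply/nbhs_ballP; exists (e%:C)%C => /=; first by rewrite ltcR.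
by move=> y; rewrite -ball_normE /= ltcR => /eP.
Qed.

Lemma cvg_normcP (u : nat -> Cx R) z : u @ \oo --> z <->
  forall e : R, 0 < e -> exists N, forall n, (N <= n)%N -> nr (z - u n) < e.
Proof.
split=> [uz e e0|uz P /nbhs_normcP[e e0 eP]].
  have [|N _ NP] := uz [set y | nr (z - y) < e]; first by apply/nbhs_normcP; exists e.
  by exists N => n; exact: NP.
by have [N NP] := uz e e0; exists N => // n /= Nn; apply: eP; exact: NP.
Qed.

Lemma normc_le_ReIm z : nr z <= `|complex.Re z| + `|complex.Im z|.
Proof.
case: z => a b /=; have h : 0 <= `|a| + `|b| by rewrite addr_ge0.
rewrite -(ger0_norm h) -sqrtr_sqr ler_wsqrtr // sqrrD !real_normK ?num_real //.
by rewrite addrAC lerDl mulrn_wge0 // mulr_ge0.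
Qed.

Lemma Re_le_normc z : `|complex.Re z| <= nr z.
Proof.
by case: z => a b /=; rewrite -sqrtr_sqr ler_wsqrtr // lerDl sqr_ge0.
Qed.

Lemma Im_le_normc z : `|complex.Im z| <= nr z.
Proof.
by case: z => a b /=; rewrite -sqrtr_sqr ler_wsqrtr // lerDr sqr_ge0.
Qed.

(** Real and imaginary parts are dominated by the modulus, so both real series converge absolutely;
    their sums are the two coordinates of the limit. *)
Lemma is_cvg_series_complex (u : nat -> Cx R) :
  cvgn (series (fun n => nr (u n))) ->
  exists z : Cx R, (fun N : nat => \sum_(n < N) u n) @ \oo --> z.
Proof.
move=> cu.
have cvg_part (f : Cx R -> R) : (forall z, `|f z| <= nr z) ->
    exists s : R, series (f \o u) @ \oo --> s.
  move=> fn; have : cvgn (series (f \o u)).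
    apply: normed_cvg; apply: series_le_cvg cu => n //=; exact: normc_ge0.
  by move=> h; exists (limn (series (f \o u))).
have [s hs] := cvg_part (@complex.Re R) Re_le_normc.
have [t ht] := cvg_part (@complex.Im R) Im_le_normc.
exists (s +i* t)%C; apply/cvg_normcP => e e0.
have e2 : 0 < e / 2 by rewrite divr_gt0.
have /cvgrPdist_lt/(_ _ e2)[N1 _ HN1] := hs.
have /cvgrPdist_lt/(_ _ e2)[N2 _ HN2] := ht.
exists (maxn N1 N2) => n; rewrite geq_max => /andP[/HN1 /= h1 /HN2 /= h2].
apply: le_lt_trans (normc_le_ReIm _) _; rewrite (splitr e).
have [hRe hIm] : complex.Re (\sum_(k < n) u k) = series (@complex.Re R \o u) n /\
    complex.Im (\sum_(k < n) u k) = series (@complex.Im R \o u) n.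
  rewrite /series /= !big_mkord; split.
    by elim/big_rec2: _ => // k y1 y2 _ <-; case: (u k) y2 => ? ? [].
  by elim/big_rec2: _ => // k y1 y2 _ <-; case: (u k) y2 => ? ? [].
apply: ltrD; [move: h1|move: h2]; rewrite -?hRe -?hIm.
  by case: (\sum_(k < n) u k).
by case: (\sum_(k < n) u k).
Qed.

End ComplexNorm.

(** * Coding of the attractor by binary sequences *)

Section CodeMap.
Variables (R : realType) (l : Cx R).
Local Notation nr := (@Normc.normc R).
Hypothesis l1 : nr l < 1.

Definition psum (a : nat -> bool) (N : nat) : Cx R :=
  \sum_(n < N) ((a n)%:R * l ^+ n).

Definition code (a : nat -> bool) : Cx R := limn (psum a).

Lemma psumS a N : psum a N.+1 = (a 0%N)%:R + l * psum (a \o succn) N.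
Proof.
rewrite /psum big_ord_recl /= expr0 mulr1; congr (_ + _).
rewrite big_distrr /=; apply: eq_bigr => i _.
by rewrite /bump /= add1n exprS mulrCA.
Qed.

Lemma code_cvg a : psum a @ \oo --> code a.
Proof.
have [|z hz] := @is_cvg_series_complex R (fun n => (a n)%:R * l ^+ n); last first.
  by apply: cvgP hz.
have r0 := normc_ge0 l.
apply: (@series_le_cvg _ _ (geometric 1 (nr l))) => [n|n|n|].
- exact: normc_ge0.
- by rewrite /= mul1r exprn_ge0.
- rewrite /= mul1r Normc.normcM normcX; case: (a n).
    by rewrite normc_1 mul1r.
  by rewrite normc_0 mul0r exprn_ge0.
- by apply: is_cvg_geometric_series; rewrite ger0_norm.
Qed.

Lemma code_unique a z : psum a @ \oo --> z -> code a = z.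
Proof. by move=> h; apply: cvg_lim h; exact: norm_hausdorff. Qed.

Lemma AsetE : Aset l = range code.
Proof.
apply/seteqP; split=> [z [a /code_unique <-]|_ [a _ <-]]; first by exists a.
by exists a; exact: code_cvg.
Qed.

Lemma code_rec a : code a = (a 0%N)%:R + l * code (a \o succn).
Proof.
apply: code_unique; rewrite -cvg_shiftS.
rewrite (_ : [sequence _]_n = (fun n => (a 0%N)%:R + l * psum (a \o succn) n)).
  by apply: cvgD; [exact: cvg_cst|apply: cvgMr; exact: code_cvg].
by apply/funext => n; exact: psumS.
Qed.

Lemma subr1_neq0 : 1 - l != 0.
Proof.
rewrite subr_eq0; apply/eqP => l1E; move: l1.
by rewrite -l1E normc_1 ltxx.
Qed.

Lemma code_true : code (fun=> true) = 1 / (1 - l).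
Proof.
have := code_rec (fun=> true); rewrite /comp => h.
by apply: (mulIf subr1_neq0); rewrite divfK ?subr1_neq0// mulrBr mulr1 {1}h mulrC addrK.
Qed.

(** Complementary digits add up to the constant sequence 1, whose sum is 1/(1-l). This is the
    central symmetry of the attractor. *)
Lemma code_compl a : code (fun n => ~~ a n) = 1 / (1 - l) - code a.
Proof.
apply: code_unique; rewrite -code_true.
rewrite (_ : psum _ = (fun n => psum (fun=> true) n - psum a n)).
  by apply: cvgB; exact: code_cvg.
apply/funext => n; rewrite /psum -sumrB; apply: eq_bigr => i _.
by rewrite -mulrBl; case: (a i); rewrite ?subrr ?subr0.
Qed.

(** The bound M solves M = 1 + |l| M, so it is preserved when the first digit is split off. *)
Lemma psum_le a n : nr (psum a n) <= (1 - nr l)^-1.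
Proof.
have d0 : 0 < 1 - nr l by rewrite subr_gt0.
elim: n a => [|n IHn] a.
  by rewrite /psum big_ord0 normc_0 invr_ge0 ltW.
rewrite psumS; apply: le_trans (normc_le_add _ _) _; rewrite Normc.normcM.
have b1 : nr (a 0%N)%:R <= 1.
  case: (a 0%N); first by rewrite normc_1.
  by rewrite normc_0.
have := ler_wpM2l (normc_ge0 l) (IHn (a \o succn)) => h.
apply: le_trans (lerD b1 h) _.
rewrite [leRHS](_ : _ = 1 + nr l / (1 - nr l)) //.
by field; rewrite gt_eqF.
Qed.

Lemma code_le a : nr (code a) <= (1 - nr l)^-1.
Proof.
rewrite leNgt; apply/negP => lt; have e0 : 0 < nr (code a) - (1 - nr l)^-1.
  by rewrite subr_gt0.
have /cvg_normcP/(_ _ e0)[N /(_ N (leqnn N)) h] := code_cvg (a := a).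
have := normc_le_add (code a - psum a N) (psum a N); rewrite subrK.
by have := psum_le a N; lra.
Qed.

(** A common prefix of length n cancels and leaves l^n times a difference of two codes. This gives
    continuity of the coding and, for n = 0, a bound on the diameter of the attractor. *)
Lemma code_dist n a b : (forall i, (i < n)%N -> a i = b i) ->
  nr (code a - code b) <= nr l ^+ n * (2 * (1 - nr l)^-1).
Proof.
elim: n a b => [|n IHn] a b ab.
  rewrite expr0 mul1r; apply: le_trans (normc_le_add _ _) _; rewrite normc_opp.
  by have := code_le a; have := code_le b; lra.
rewrite code_rec (code_rec b) ab // opprD addrACA subrr add0r -mulrBr Normc.normcM.
rewrite exprS -mulrA; apply: ler_wpM2l; first exact: normc_ge0.
by apply: IHn => i ni /=; exact: ab.
Qed.

Lemma normc_expr_lt (e : R) : 0 < e -> exists n, nr l ^+ n < e.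
Proof.
move=> e0; have r0 := normc_ge0 l.
have /cvg_expr/cvgrPdist_lt/(_ _ e0)[N _ /(_ N (leqnn N)) /=] : `|nr l| < 1.
  by rewrite ger0_norm.
by rewrite sub0r normrN ger0_norm ?exprn_ge0 // => h; exists N.
Qed.

Lemma code_continuous : continuous (code : cantor_space -> Cx R).
Proof.
move=> a P /nbhs_normcP[e e0 eP].
have d0 : 0 < 2 * (1 - nr l)^-1 by rewrite mulr_gt0 // invr_gt0 subr_gt0.
have [n ln] := normc_expr_lt (divr_gt0 e0 d0).
have : nbhs (a : cantor_space) [set b : cantor_space | forall i, (i < n)%N -> a i = b i].
  elim: n {ln} => [|n IHn]; first by apply: filterS filterT.
  have hn : nbhs (a : cantor_space) [set b : cantor_space | a n = b n].
    have /(_ a) := @proj_continuous nat (fun=> bool) n.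
    move=> /(_ [set x | a n = x]); apply.
    by rewrite /nbhs/= /principal_filter /=.
  apply: filterS (filterI IHn hn) => b [h1 h2] i.
  by rewrite ltnS leq_eqVlt => /orP[/eqP->|/h1].
apply: filterS => b ab; apply: eP.
by apply: le_lt_trans (code_dist ab) _; rewrite -ltr_pdivlMr.
Qed.

Lemma Aset_compact : compact (Aset l).
Proof.
rewrite AsetE; apply: (@continuous_compact cantor_space).
  exact: continuous_subspaceT code_continuous.
exact: cantor_space_compact.
Qed.

End CodeMap.

(** * Positive distances from compactness *)

Section Gaps.
Variable R : realType.
Implicit Types (x y z : Cx R) (A : set (Cx R)).
Local Notation nr := (@Normc.normc R).

(** F(E) is compact, hence closed, and misses 0, so it misses a ball around 0. *)
Lemma compact_gap (T : topologicalType) (E : set T) (F : T -> Cx R) :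
  compact E -> continuous F -> (forall t, E t -> F t <> 0) ->
  exists2 e : R, 0 < e & forall t, E t -> e <= nr (F t).
Proof.
move=> cE cF F0.
have cFE : closed (F @` E).
  apply: compact_closed; first exact: norm_hausdorff.
  by apply: continuous_compact cE; exact: continuous_subspaceT.
have : nbhs (0 : Cx R) (~` (F @` E)).
  apply: open_nbhs_nbhs; split; first exact: closed_openC.
  by move=> [t Et]; exact: F0.
move=> /nbhs_normcP[e e0 eP]; exists e => // t Et.
rewrite leNgt; apply/negP => lt; apply: (eP (F t)); last by exists t.
by rewrite sub0r normc_opp.
Qed.

Lemma translate_continuous (v : Cx R) : continuous (fun z : Cx R => z - v).
Proof.
move=> z P /nbhs_normcP[e e0 eP].
change (nbhs z [set y | P (y - v)]); apply/nbhs_normcP; exists e => // y zy.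
by apply: eP; rewrite opprB addrA subrK.
Qed.

Lemma closed_far p (d : R) : closed [set z : Cx R | d <= nr (z - p)].
Proof.
rewrite -[X in closed X]setCK; apply: open_closedC.
rewrite (_ : ~` _ = [set z | nr (z - p) < d]); last first.
  by apply/seteqP; split=> z /=; [move/negP; rewrite -ltNge|rewrite ltNge => /negP].
rewrite openE => z /= zd; rewrite /interior /=; apply/nbhs_normcP; exists (d - nr (z - p)).
  by rewrite subr_gt0.
move=> y; rewrite normc_distC => yz /=.
by have := normc_le_add (y - z) (z - p); rewrite addrA subrK; lra.
Qed.

End Gaps.

(** * Self-similar sets whose two pieces meet in one point *)

Section SelfSimilar.
Variables (R : realType) (l c : Cx R) (A : set (Cx R)) (a : Cx R) (D : R).
Local Notation nr := (@Normc.normc R).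

(* [branch true] is not the map [z |-> l * z + 1] but its composition with the
   symmetry [z |-> c - z] of the attractor, and so inverts the second branch of
   [qmap]. *)
Definition branch (b : bool) (z : Cx R) : Cx R := if b then c - l * z else l * z.

Hypotheses (l0 : l != 0) (l1 : nr l < 1) (cA : compact A) (Aa : A a) (D0 : 0 < D).
Hypothesis A_diam : forall x y, A x -> A y -> nr (x - y) <= D.
Hypothesis A_branch : forall b z, A z -> A (branch b z).
Hypothesis A_cover : forall z, A z -> exists b z', A z' /\ z = branch b z'.
Hypothesis branch_a : branch false a = branch true a.
Hypothesis branch_inj_a :
  forall x y, A x -> A y -> branch false x = branch true y -> x = a.

Lemma branch_dist b x y : nr (branch b x - branch b y) = nr l * nr (x - y).
Proof.
rewrite /branch -Normc.normcM mulrBr; case: b => //.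
by rewrite opprB addrC addrA subrK normc_distC.
Qed.

Lemma branch_inj b : injective (branch b).
Proof.
move=> x y; rewrite /branch; case: b => [/addrI/oppr_inj|]; exact: mulfI.
Qed.

Lemma branch_continuous b : continuous (branch b).
Proof.
move=> z P /nbhs_normcP[e e0 eP].
change (nbhs z (branch b @^-1` P)); apply/nbhs_normcP; exists e => // y zy; apply: eP.
rewrite branch_dist; apply: le_lt_trans zy.
by apply: ler_piMl; [exact: normc_ge0|exact: ltW].
Qed.

Lemma branch_sum b x y z : x + y = z + z -> branch b x + branch b y = branch b z + branch b z.
Proof.
move=> xyz; rewrite /branch; case: b; last by rewrite -!mulrDr xyz.
by rewrite addrACA [RHS]addrACA -!opprD -!mulrDr xyz.
Qed.

(* Two complementary clopen parts have a positive distance, so all sufficiently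
   small affine copies of A lie in one part; this ascends from the two halves of a
   copy to the whole copy because the halves share a point. *)
Lemma A_connected : connected A.
Proof.
move=> B B0 [U oU BU] [V cV BV]; apply/seteqP; split=> [|y Ay]; first by rewrite BU => z [].
have BA : B `<=` A by rewrite BU => z [].
have cB : compact B by rewrite BV; exact: compact_closedI.
have cAB : compact (A `\` B).
  rewrite (_ : _ `\` _ = A `&` ~` U); first by apply: compact_closedI => //; exact: open_closedC.
  apply/seteqP; split=> z [Az]; last by move=> nU; split=> //; rewrite BU => -[].
  by rewrite BU => nU; split=> // Uz; apply: nU.
have [e e0 eP] : exists2 e : R, 0 < e &
    forall t, (B `*` (A `\` B)) t -> e <= nr (t.1 - t.2).
  apply: compact_gap; first exact: compact_setX.
    by move=> t; apply: cvgB; [exact: cvg_fst|exact: cvg_snd].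
  by move=> [x z] [/= Bx [Az nBz]] /subr0_eq xz; apply: nBz; rewrite -xz.
have main n : forall (s t : Cx R), (forall z, A z -> A (s * z + t)) ->
    nr s * nr l ^+ n * D < e ->
    forall x z, A x -> A z -> B (s * x + t) -> B (s * z + t).
  elim: n => [|n IHn] s t Ast se x z Ax Az Bx.
    apply: contrapT => nBz.
    have := eP (s * x + t, s * z + t) (conj Bx (conj (Ast _ Az) nBz)).
    rewrite /= opprD addrACA subrr addr0 -mulrBr Normc.normcM leNgt => /negP; apply.
    apply: le_lt_trans se; rewrite expr0 mulr1.
    by apply: ler_wpM2l; [exact: normc_ge0|exact: A_diam].
  have step b x1 z1 : A x1 -> A z1 -> B (s * branch b x1 + t) -> B (s * branch b z1 + t).
    (* A branch followed by w |-> s w + t is again an affine copy, of ratio s l up to sign; the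
       extra factor |l| pays for the passage from n+1 to n. *)
    pose s' := if b then - (s * l) else s * l; pose t' := if b then s * c + t else t.
    have E w : s * branch b w + t = s' * w + t'.
      by rewrite /branch /s' /t'; case: (b); ring.
    have s'l : nr s' = nr s * nr l.
      by rewrite /s' -Normc.normcM; case: (b) => //; rewrite normc_opp.
    rewrite !E; apply: IHn.
      by move=> w Aw; rewrite -E; apply: Ast; exact: A_branch.
    by rewrite s'l -[nr s * _ * _]mulrA -exprS.
  have [b1 [x1 [Ax1 xE]]] := A_cover Ax; have [b2 [z1 [Az1 zE]]] := A_cover Az.
  rewrite zE; apply: (step b2 a) => //.
  have -> : branch b2 a = branch b1 a by case: b2 {zE}; case: b1 {xE}.
  by move: Bx; rewrite xE; exact: step.
have [n ln] := normc_expr_lt l1 (divr_gt0 e0 D0).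
have [x Bx] := B0.
have := main n 1 0 _ _ x y; rewrite !mul1r !addr0; apply=> //.
- by move=> z; rewrite mul1r addr0.
- by rewrite normc_1 mul1r -ltr_pdivlMr.
- exact: BA.
Qed.


(** * Joining points by connected sets of controlled diameter *)

Definition joined (d : R) (x y : Cx R) : Prop := exists K : set (Cx R),
  [/\ K `<=` A, K x, K y, connected K &
      forall w w', K w -> K w' -> nr (w - w') <= d].

Lemma joined_le d e x y : d <= e -> joined d x y -> joined e x y.
Proof.
move=> de [K [KA Kx Ky cK Kd]]; exists K; split=> // w w' Kw Kw'.
by apply: le_trans de; exact: Kd.
Qed.

Lemma joined_refl x : A x -> joined 0 x x.
Proof.
move=> Ax; exists [set x]; split=> // [_ -> //||_ _ -> ->]; first exact: connected1.
by rewrite subrr normc_0.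
Qed.

Lemma joined_diam x y : A x -> A y -> joined D x y.
Proof. by move=> Ax Ay; exists A; split=> //; exact: A_connected. Qed.

Lemma joined_branch b d x y :
  joined d x y -> joined (nr l * d) (branch b x) (branch b y).
Proof.
move=> [K [KA Kx Ky cK Kd]]; exists (branch b @` K); split.
- by move=> _ [z Kz <-]; apply: A_branch; exact: KA.
- by exists x.
- by exists y.
- apply: connected_continuous_connected => //.
  by apply: continuous_subspaceT; exact: branch_continuous.
- move=> _ _ [w Kw <-] [w' Kw' <-]; rewrite branch_dist.
  by apply: ler_wpM2l; [exact: normc_ge0|exact: Kd].
Qed.

Lemma joined_trans d e x y z :
  joined d x y -> joined e y z -> joined (d + e) x z.
Proof.
move=> [K [KA Kx Ky cK Kd]] [H [HA Hy Hz cH He]]; exists (K `|` H); split.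
- by move=> w [/KA|/HA].
- by left.
- by right.
- by apply: connectedU => //; exists y.
have d0 : 0 <= d by apply: le_trans (Kd _ _ Kx Kx); exact: normc_ge0.
have e0 : 0 <= e by apply: le_trans (He _ _ Hz Hz); exact: normc_ge0.
have KH w w' : K w -> H w' -> nr (w - w') <= d + e.
  move=> Kw Hw'; rewrite -(subrK y w) -addrA.
  by apply: le_trans (normc_le_add _ _) _; apply: lerD; [exact: Kd|exact: He].
move=> w w' [Kw|Hw] [Kw'|Hw'].
- by apply: le_trans (Kd _ _ Kw Kw') _; rewrite lerDl.
- exact: KH.
- by rewrite normc_distC; exact: KH.
- by apply: le_trans (He _ _ Hw Hw') _; rewrite lerDr.
Qed.

(* [p k] stands for the [k.+1]-st iterate of the common point
   [branch false a = branch true a] under the map inverting the branches. *)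
Variable p : nat -> Cx R.
Hypotheses (p0 : p 0%N = a) (Ap : forall k, A (p k)).
Hypothesis p_branch : forall k, exists b, p k = branch b (p k.+1).
Hypothesis p_regular : forall k, p k <> branch false a.
Hypothesis p_finite : exists N, forall k, exists2 j, (j < N)%N &
  p j = p k /\ p j.+1 = p k.+1.

(** * Estimates at the postcritical points *)

Lemma branch_aE b b' : branch b a = branch b' a.
Proof. by case: b; case: b'. Qed.

(** The relation [branch_a] says c = 2 l a, so the second branch is x |-> 2 l a - l x. Distances
    across the two pieces therefore become sums centred at a, the source of the expressions x + y -
    2 p_k. *)
Lemma branch_cross b x y :
  nr (branch b x - branch (~~ b) y) = nr l * nr (x + y - (a + a)).
Proof.
have cE : c = l * a + l * a by rewrite -[X in X + _]/(branch false a) branch_a subrK.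
rewrite -Normc.normcM /branch cE; case: b => /=; last by congr Normc.normc; ring.
by rewrite -normc_opp; congr Normc.normc; ring.
Qed.

Lemma branch_center b x y z :
  nr (branch b x + branch b y - (branch b z + branch b z)) = nr l * nr (x + y - (z + z)).
Proof.
rewrite -Normc.normcM /branch; case: b; last by congr Normc.normc; ring.
by rewrite -normc_opp; congr Normc.normc; ring.
Qed.

(** Finitely many pairs (p_k, p_{k+1}) occur, so a minimum of finitely many constants serves all k.
    Pairs are used because the piece containing p_k is described through p_{k+1}. *)
Lemma p_uniform (P : Cx R -> Cx R -> R -> Prop) :
  (forall u v d e, P u v d -> e <= d -> P u v e) ->
  (forall k, exists2 d, 0 < d & P (p k) (p k.+1) d) ->
  exists2 d, 0 < d & forall k, P (p k) (p k.+1) d.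
Proof.
move=> Ple Pp; have [N HN] := p_finite.
suff [d d0 dP] : exists2 d, 0 < d & forall k, (k < N)%N -> P (p k) (p k.+1) d.
  by exists d => // k; have [j jN [<- <-]] := HN k; exact: dP.
elim: N {HN} => [|N [d d0 dP]]; first by exists 1.
have [e e0 eP] := Pp N; exists (Num.min d e); first by rewrite lt_min d0.
move=> k; rewrite ltnS leq_eqVlt => /orP[/eqP->|kN].
  by apply: Ple eP _; rewrite ge_min lexx orbT.
by apply: Ple (dP k kN) _; rewrite ge_min lexx.
Qed.

(** As p_k is not the common point, it lies outside the other piece, which is compact and so at
    positive distance. *)
Lemma p_near_piece : exists2 d : R, 0 < d & forall k, exists b,
  p k = branch b (p k.+1) /\
  forall x, A x -> nr (x - p k) < d -> exists2 x1, A x1 & x = branch b x1.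
Proof.
apply: (p_uniform (P := fun u v d => exists b, u = branch b v /\
  forall x, A x -> nr (x - u) < d -> exists2 x1, A x1 & x = branch b x1)).
  move=> u v d e [b [uE H]] ed; exists b; split=> // x Ax xe.
  by apply: H => //; exact: lt_le_trans ed.
move=> k; have [b pE] := p_branch k.
have [d d0 dP] : exists2 d : R, 0 < d &
    forall t, (branch (~~ b) @` A) t -> d <= nr (t - p k).
  apply: compact_gap.
  - by apply: continuous_compact cA; apply: continuous_subspaceT; exact: branch_continuous.
  - exact: translate_continuous.
  - move=> _ [y Ay <-] /subr0_eq yp; apply: (p_regular (k := k)).
    case: b pE yp => pE yp.
      by rewrite -yp -(branch_inj_a Ay (Ap k.+1)) // yp.
    by rewrite pE (branch_inj_a (Ap k.+1) Ay) // yp.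
exists d => //; exists b; split=> // x Ax xd.
have [b' [x1 [Ax1 xE]]] := A_cover Ax.
have [bb'|bb'] := eqVneq b' b; first by exists x1; rewrite // -bb'.
have /dP : (branch (~~ b) @` A) x.
  by exists x1 => //; rewrite xE; congr branch; case: (b) (b') bb' => -[].
by rewrite leNgt xd.
Qed.

(** For k = 0, x + y = 2a puts the images of x and y under opposite branches at the same point,
    which forces x = a. For k+1, the branch taking p_{k+1} to p_k preserves midpoints and reduces to
    k. *)
Lemma p_center_inj k x y : A x -> A y -> x + y = p k + p k -> x = p k.
Proof.
elim: k x y => [|k IHk] x y Ax Ay xy.
  rewrite p0; apply: (branch_inj_a (y := y)) => //; apply/subr0_eq/Normc.eq0_normc.
  rewrite (branch_cross false) xy p0 subrr.
  by rewrite normc_0 mulr0.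
have [b pE] := p_branch k; apply: (@branch_inj b); rewrite -pE.
apply: (IHk _ (branch b y)); [exact: A_branch|exact: A_branch|].
by rewrite pE; exact: branch_sum.
Qed.

Lemma p_far_gap (d : R) : 0 < d -> exists2 e : R, 0 < e & forall k x y,
  A x -> A y -> d <= nr (x - p k) -> e <= nr (x + y - (p k + p k)).
Proof.
move=> d0; apply: (p_uniform (P := fun u _ e => forall x y,
  A x -> A y -> d <= nr (x - u) -> e <= nr (x + y - (u + u)))).
  by move=> u _ e f H fe x y Ax Ay xd; apply: le_trans fe _; exact: H.
move=> k; have [e e0 eP] : exists2 e : R, 0 < e & forall t,
    ((A `&` [set z | d <= nr (z - p k)]) `*` A) t -> e <= nr (t.1 + t.2 - (p k + p k)).
  apply: compact_gap.
  - by apply: compact_setX => //; apply: compact_closedI => //; exact: closed_far.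
  - move=> t; apply: cvgB; last exact: cvg_cst.
    by apply: cvgD; [exact: cvg_fst|exact: cvg_snd].
  - move=> [x y] /= [[Ax xd] Ay] /subr0_eq /(p_center_inj Ax Ay) xp.
    by move: xd; rewrite xp subrr normc_0 leNgt d0.
by exists e => // x y Ax Ay xd; apply: (eP (x, y)).
Qed.

Lemma scale_below (d e : R) : 0 < d -> 0 < e -> exists n, d * nr l ^+ n <= e.
Proof.
move=> d0 e0; have [n ln] := normc_expr_lt l1 (divr_gt0 e0 d0).
by exists n; rewrite mulrC -ler_pdivlMr // ltW.
Qed.

Lemma transversal : exists2 C : R, 0 < C & forall k x y, A x -> A y ->
  nr (x - p k) + nr (y - p k) <= C * nr (x + y - (p k + p k)).
Proof.
have [d d0 near] := p_near_piece; have [e e0 far] := p_far_gap d0.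
have r0 : 0 < nr l by apply: normc_gt0; apply/eqP.
have C0 : 0 < (D + D) / e by rewrite divr_gt0 // addr_gt0.
(* If x or y is at distance at least d from p_k, the left side is at most 2D and the centred sum has
   modulus at least e. *)
exists ((D + D) / e) => //.
have far' k x y : A x -> A y -> d <= nr (x - p k) \/ d <= nr (y - p k) ->
    nr (x - p k) + nr (y - p k) <= (D + D) / e * nr (x + y - (p k + p k)).
  move=> Ax Ay xyd.
  have h : e <= nr (x + y - (p k + p k)).
    by case: xyd => [|yd]; [exact: far|rewrite (addrC x); exact: far].
  apply: (@le_trans _ _ (D + D)); first by apply: lerD; exact: A_diam.
  by rewrite mulrAC ler_pdivlMr // ler_wpM2l // ltW // addr_gt0.
(* n bounds the number of pull-backs before x or y is at distance at least d from the current p_k.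
   Each pull-back divides both sides by |l|, so the constant is unchanged. *)
have main n : forall k x y, A x -> A y ->
    d * nr l ^+ n <= nr (x - p k) \/ d * nr l ^+ n <= nr (y - p k) ->
    nr (x - p k) + nr (y - p k) <= (D + D) / e * nr (x + y - (p k + p k)).
  elim: n => [|n IHn] k x y Ax Ay; first by rewrite expr0 mulr1; exact: far'.
  move=> xyn; have [xd|xd] := leP d (nr (x - p k)); first by apply: far' => //; left.
  have [yd|yd] := leP d (nr (y - p k)); first by apply: far' => //; right.
  have [b [pE near_b]] := near k.
  have [x1 Ax1 xE] := near_b x Ax xd; have [y1 Ay1 yE] := near_b y Ay yd.
  move: xyn; rewrite xE yE pE !branch_dist branch_center exprS mulrCA !ler_pM2l // => xyn.
  by rewrite -mulrDr mulrCA ler_pM2l //; exact: IHn.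
move=> k x y Ax Ay; have [->|/eqP xp] := eqVneq x (p k); last first.
  have [n nx] := scale_below d0 (normc_gt0 (fun h => xp (subr0_eq h))).
  by apply: (main n) => //; left.
have [->|/eqP yp] := eqVneq y (p k); last first.
  have [n ny] := scale_below d0 (normc_gt0 (fun h => yp (subr0_eq h))).
  by apply: (main n) => //; right.
rewrite subrr normc_0 addr0.
by rewrite mulr_ge0 ?normc_ge0 // ltW.
Qed.

Lemma joined_p : exists2 L : R, 0 < L & forall k x, A x ->
  joined (L * nr (x - p k)) x (p k).
Proof.
have [d d0 near] := p_near_piece.
have r0 : 0 < nr l by apply: normc_gt0; apply/eqP.
(* At distance at least d from p_k the whole of A serves as joining set, and D <= (D / d) |x - p_k|;
   nearer points are pulled back. *)
exists (D / d); first exact: divr_gt0.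
have far k x : A x -> d <= nr (x - p k) -> joined (D / d * nr (x - p k)) x (p k).
  move=> Ax xd; apply: joined_le (joined_diam Ax (Ap k)).
  by rewrite mulrAC ler_pdivlMr // ler_wpM2l // ltW.
have main n : forall k x, A x -> d * nr l ^+ n <= nr (x - p k) ->
    joined (D / d * nr (x - p k)) x (p k).
  elim: n => [|n IHn] k x Ax; first by rewrite expr0 mulr1; exact: far.
  move=> xn; have [xd|xd] := leP d (nr (x - p k)); first exact: far.
  have [b [pE near_b]] := near k; have [x1 Ax1 xE] := near_b x Ax xd.
  move: xn; rewrite xE pE branch_dist exprS mulrCA ler_pM2l // => xn.
  by rewrite mulrCA; apply: joined_branch; exact: IHn.
move=> k x Ax; have [->|/eqP xp] := eqVneq x (p k); last first.
  have [n nx] := scale_below d0 (normc_gt0 (fun h => xp (subr0_eq h))).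
  exact: (main n).
rewrite subrr normc_0 mulr0.
exact: joined_refl.
Qed.

Lemma joined_turning : exists2 L : R, 0 < L & forall x y, A x -> A y ->
  joined (L * nr (x - y)) x y.
Proof.
have [C C0 trans] := transversal; have [L L0 joinL] := joined_p.
have r0 : 0 < nr l by apply: normc_gt0; apply/eqP.
exists (L * C); first exact: mulr_gt0.
(* Pull-backs inside a common piece expand distances by 1/|l|; the base case is vacuous because D
   bounds the diameter of A. *)
have main n : forall x y, A x -> A y -> D * nr l ^+ n < nr (x - y) ->
    joined (L * C * nr (x - y)) x y.
  elim: n => [|n IHn] x y Ax Ay.
    by rewrite expr0 mulr1 ltNge A_diam.
  have [b [x1 [Ax1 xE]]] := A_cover Ax; have [b' [y1 [Ay1 yE]]] := A_cover Ay.
  rewrite xE yE; have [<-|bb'] := eqVneq b b'.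
    rewrite branch_dist exprS mulrCA ltr_pM2l // => xy.
    by rewrite mulrCA; apply: joined_branch; exact: IHn.
  move=> _; have {bb'}-> : b' = ~~ b by case: b b' bb' {xE yE} => -[].
  (* Points in different pieces are joined through the common point. The total |l| L (|x1 - a| + |y1
     - a|) is at most L C |x - y| by transversality at p_0 = a. *)
  have jx := joined_branch b (joinL 0%N x1 Ax1).
  have jy := joined_branch (~~ b) (joinL 0%N y1 Ay1).
  rewrite p0 in jx jy.
  have jy' : joined (nr l * (L * nr (y1 - a))) (branch b a) (branch (~~ b) y1).
    by rewrite (branch_aE b (~~ b)); case: jy => K [*]; exists K; split.
  apply: joined_le (joined_trans jx jy'); rewrite branch_cross.
  have := trans 0%N x1 y1 Ax1 Ay1; rewrite p0 => h.
  by rewrite -!mulrDr [leRHS]mulrCA ler_pM2l // -mulrA ler_pM2l.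
move=> x y Ax Ay; have [->|/eqP xy] := eqVneq x y.
  rewrite subrr normc_0 mulr0.
  exact: joined_refl.
have [n ln] := normc_expr_lt l1 (divr_gt0 (normc_gt0 (fun h => xy (subr0_eq h))) D0).
by apply: (main n) => //; rewrite mulrC -ltr_pdivlMr.
Qed.

End SelfSimilar.

(** * Local connectedness from bounded turning *)

Section LocalConnectedness.
Variables (R : realType) (X : set (Cx R)) (L : R).
Local Notation nr := (@Normc.normc R).
Hypothesis L0 : 0 < L.
Hypothesis X_turn : forall x y, X x -> X y -> joined X (L * nr (x - y)) x y.

Lemma turning_locally_connected : locally_connected X.
Proof.
move=> x Xx U oU Ux; set C := connected_component (U `&` X) x.
have CUX : C `<=` U `&` X by exact: connected_component_sub.
(* The component C is relatively open: a point of X within e / L of y is joined to y by a connected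
   set of diameter below e, which stays in U. *)
have CV y : C y -> nbhs y (C `|` ~` X).
  move=> Cy; have [Uy Xy] := CUX y Cy.
  have /nbhs_normcP[e e0 eU] : nbhs y U by exact: open_nbhs_nbhs.
  apply/nbhs_normcP; exists (e / L) => [|z yz]; first exact: divr_gt0.
  have [Xz|] := pselect (X z); [left|by right].
  have [K [KX Ky Kz cK Kd]] := X_turn Xy Xz.
  apply: connected_component_trans Cy _; exists K => //; split=> // w Kw; split; last exact: KX.
  by apply: eU; apply: le_lt_trans (Kd _ _ Ky Kw) _; rewrite mulrC -ltr_pdivlMr.
have VXE : (C `|` ~` X)° `&` X = C.
  apply/seteqP; split=> [y [/interior_subset[]//]|y Cy].
  by split; [exact: CV|exact: (CUX y Cy).2].
exists (C `|` ~` X)°; rewrite VXE; split.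
- exact: open_interior.
- by apply: CV; exact: connected_component_refl.
- by move=> y /CUX[].
- exact: component_connected.
Qed.

End LocalConnectedness.

(** * The attractor as a union of two inverse branches of the map *)

Section SymmetricAttractor.
Variables (R : realType) (l : Cx R).
Local Notation nr := (@Normc.normc R).
Hypothesis l1 : nr l < 1.
Local Notation c := (1 / (1 - l)).
Local Notation branch := (branch l c).

Lemma Aset_flip z : Aset l z -> Aset l (c - z).
Proof.
rewrite AsetE // => -[s _ <-]; exists (fun n => ~~ s n) => //.
exact: code_compl.
Qed.

Lemma Aset_scale z : Aset l z -> Aset l (l * z).
Proof.
rewrite AsetE // => -[s _ <-]; exists (fun n => if n is n'.+1 then s n' else false) => //.
by rewrite code_rec // add0r.
Qed.

Lemma Aset_branch b z : Aset l z -> Aset l (branch b z).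
Proof. by case: b => Az; [apply: Aset_flip|]; exact: Aset_scale. Qed.

Lemma branch_true_flip z : branch true (c - z) = l * z + 1.
Proof. by have := subr1_neq0 l1; rewrite /branch => h; field. Qed.

(** Since z |-> c - z preserves the attractor, reparametrising by it turns l z + 1 into the
    orientation used by the second branch of [qmap]. *)
Lemma lA1E : lA1 l = branch true @` Aset l.
Proof.
apply/seteqP; split=> [_ [z Az <-]|_ [z Az <-]]; exists (c - z).
- exact: Aset_flip.
- exact: branch_true_flip.
- exact: Aset_flip.
- by rewrite -branch_true_flip subKr.
Qed.

Lemma Aset_cover z : Aset l z -> exists b z', Aset l z' /\ z = branch b z'.
Proof.
rewrite {1}AsetE // => -[s _ <-].
have As : Aset l (code l (s \o succn)) by rewrite AsetE //; eexists.
rewrite code_rec //; case: (s 0%N).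
  exists true, (c - code l (s \o succn)); split; first exact: Aset_flip.
  by rewrite branch_true_flip addrC.
by exists false, (code l (s \o succn)); split; rewrite // add0r.
Qed.

Lemma qmapP z : l != 0 -> Aset l z ->
  exists b, Aset l (qmap l z) /\ z = branch b (qmap l z).
Proof.
move=> l0 Az; rewrite /qmap; case: asboolP => [[w Aw <-]|nz].
  have -> : l * w / l = w by rewrite mulrC mulKf.
  by exists false.
have [b [w [Aw zE]]] := Aset_cover Az; case: b zE => zE; last first.
  by exfalso; apply: nz; exists w.
have d0 := subr1_neq0 l1.
suff -> : (1 - z) / l + c = w by exists true.
by rewrite zE /branch; field; rewrite d0.
Qed.

End SymmetricAttractor.

(** * Finiteness of the postcritical orbit and conclusion *)

Lemma iter_eventually_periodic (T : Type) (f : T -> T) x m n k : (0 < n)%N ->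
  iter (m + n) f x = iter m f x -> exists2 j, (j < m + n)%N & iter j f x = iter k f x.
Proof.
move=> n0 mn; elim/ltn_ind: k => k IHk.
have [km|mk] := ltnP k (m + n); first by exists k.
have nk : (n <= k)%N by rewrite (leq_trans _ mk) // leq_addl.
have [|j jmn jE] := IHk (k - n)%N; first by rewrite ltn_subrL n0 (leq_trans n0).
exists j => //; rewrite jE.
have mkn : (m <= k - n)%N by rewrite leq_subRL // addnC.
rewrite -[in RHS](subnK nk) -[in RHS](subnK mkn) -addnA iterD mn -iterD.
by rewrite subnK.
Qed.

Theorem theorem2p1 (R : realType) (l : Cx R) :
  inT l -> pcf l -> bounded_turning (Aset l).
Proof.
move=> [l1' _] [z [zE [[m [n [n0 mn]]] z_per]]].
have l1 : Normc.normc l < 1 by rewrite -ltcR.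
have [z_lA z_lA1] : (lA l `&` lA1 l) z by rewrite zE.
have l0 : l != 0.
  (* For l = 0 the two pieces would be {0} and {1}, which are disjoint. *)
  apply/eqP => l0; move: z_lA z_lA1; rewrite l0 => -[x _ <-] [y _].
  by rewrite !mul0r add0r => /eqP; rewrite oner_eq0.
pose c : Cx R := 1 / (1 - l); pose a : Cx R := z / l.
have la : l * a = z by rewrite /a mulrC divfK.
have Aa : Aset l a by move: z_lA => [x Ax xz]; rewrite /a -xz mulrC mulKf.
have lA1E := lA1E l1.
(* The central symmetry exchanges the two pieces, so it fixes their only common point. *)
have zz : c - z = z.
  suff : (lA l `&` lA1 l) (c - z) by rewrite zE.
  split; last by rewrite lA1E; exists a; rewrite // /branch la.
  move: z_lA1; rewrite lA1E => -[y Ay <-]; exists y => //.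
  by rewrite /branch subKr.
have branch_a : branch l c false a = branch l c true a by rewrite /branch la.
have inj_a x y : Aset l x -> Aset l y -> branch l c false x = branch l c true y -> x = a.
  move=> Ax Ay xy; suff : (lA l `&` lA1 l) (l * x).
    by rewrite zE => /= h; rewrite /a -h mulrC mulKf.
  by split; [exists x|rewrite lA1E; exists y].
have d0 : 0 < 1 - Normc.normc l by rewrite subr_gt0.
have D0 : 0 < 2 * (1 - Normc.normc l)^-1 by rewrite mulr_gt0 // invr_gt0.
have diam x y : Aset l x -> Aset l y -> Normc.normc (x - y) <= 2 * (1 - Normc.normc l)^-1.
  rewrite AsetE // => -[s _ <-] [t _ <-].
  have := @code_dist R l l1 0 s t; rewrite expr0 mul1r; exact.
pose p k := iter k.+1 (qmap l) z.
have Az : Aset l z by rewrite -la; exact: Aset_scale.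
have Ap k : Aset l (iter k (qmap l) z).
  elim: k => [|k Ak]; first exact: Az.
  by rewrite iterS; have [b [Aq _]] := qmapP l1 l0 Ak; exact: Aq.
have p0 : p 0%N = a by rewrite /p /= /qmap (asboolT z_lA).
have p_branch k : exists b, p k = branch l c b (p k.+1).
  by have [b [_ h]] := qmapP l1 l0 (Ap k.+1); exists b.
have p_regular k : p k <> branch l c false a.
  by rewrite /branch la; exact: z_per.
have p_finite : exists N, forall k, exists2 j, (j < N)%N & p j = p k /\ p j.+1 = p k.+1.
  (* The orbit of z is indexed from 0 but p starts at the first iterate. The index 0 is excluded
     because z is never revisited, and applying q to an equality of iterates gives the second
     component of the pair. *)
  exists (m + n)%N => k; have [[|j] jN jE] := iter_eventually_periodic k.+1 n0 mn.
    by exfalso; apply: (z_per k.+1).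
  by exists j; [exact: ltnW|split; [exact: jE|exact: (congr1 (qmap l) jE)]].
have [L L0 turn] := joined_turning l0 l1 (Aset_compact l1) Aa D0 diam (@Aset_branch R l l1)
  (@Aset_cover R l l1) branch_a inj_a p0 (fun k => Ap k.+1) p_branch p_regular p_finite.
split.
- exact: (A_connected l1 (Aset_compact l1) Aa D0 diam (@Aset_branch R l l1) (@Aset_cover R l l1)).
- exact: turning_locally_connected turn.
exists L => x y Ax Ay; have [K [KA Kx Ky cK Kd]] := turn x y Ax Ay.
by exists K; split=> // w w' Kw Kw'; rewrite -[`|_|]/(_%:C)%C -rmorphM lecR; exact: Kd.
Qed.
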